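(* Let $C\subset\mathbb{R}^n$ be nonempty, compact and convex, let $U\subset\mathbb{R}^n$ be open and convex with $C\cap U\neq\emptyset$, and let $f:U\to\mathbb{R}$ be twice continuously differentiable and convex. Assume boundary blow-up: for every $\alpha\in\mathbb{R}$ such that $L_\alpha:=\{p\in C\cap U\mid f(p)\le\alpha\}$ is nonempty, $\operatorname{dist}(L_\alpha,U^c)>0$. Run the domain-aware Armijo projected gradient method (described in the context) from $p^{(0)}\in C\cap U$ with parameters $\bar\alpha>0$, $\sigma,\rho\in(0,1)$ and $\varepsilon=0$. Let $p^\star$ be any minimizer of $f$ over $C\cap U$ and set $f^\star:=f(p^\star)$. Then, for every integer $K\ge0$ such that $p^{(0)},\dots,p^{(K+1)}$ are generated, $$\min_{k=0,\dots,K}\|\mathcal G_{\alpha_k}(p^{(k)})\|\le\sqrt{\frac{f(p^{(0)})-f^\star}{\sigma\underline\alpha(K+1)}}$$ and $$f(p^{(K)})-f^\star\le\frac{\|p^{(0)}-p^\star\|^2+2\bar\alpha\big(f(p^{(0)})-f^\star\big)/\sigma}{2\underline\alpha(K+1)}.$$ If the generated sequence is infinite, then $$\sum_{k=0}^\infty\|\mathcal G_{\alpha_k}(p^{(k)})\|^2\le\frac{f(p^{(0)})-f^\star}{\sigma\underline\alpha}\qquad\text{and}\qquad \|\mathcal G_{\alpha_k}(p^{(k)})\|\to0\ \text{ as }k\to\infty.$$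
   Context: $\|\cdot\|$ is the Euclidean norm, $\|\cdot\|_2$ the spectral norm of a matrix, $P_C$ the Euclidean projection onto $C$, $U^c=\mathbb{R}^n\setminus U$, and $\operatorname{dist}(A,B)=\inf\{\|a-b\|: a\in A,b\in B\}$, with the convention $\operatorname{dist}(A,\emptyset)=+\infty$; $\operatorname{dist}(q,B)=\operatorname{dist}(\{q\},B)$. Gradient mapping: for $p\in C\cap U$ and $\alpha>0$, $\mathcal G_\alpha(p):=\alpha^{-1}\big(p-P_C(p-\alpha\nabla f(p))\big)$. The constant $\underline\alpha$: let $\mathcal F^{(0)}:=\{p\in C\cap U\mid f(p)\le f(p^{(0)})\}$, $d:=\operatorname{dist}(\mathcal F^{(0)},U^c)$, $r:=\min\{1,d/2\}$, $\mathcal K_r:=\{q\in\mathbb{R}^n\mid \operatorname{dist}(q,\mathcal F^{(0)})\le r\}$ (under the hypotheses $d>0$ and $\mathcal K_r$ is a compact subset of $U$), $G:=\max\{1,\max_{p\in\mathcal F^{(0)}}\|\nabla f(p)\|\}$, $L:=\max\{1,\max_{q\in\mathcal K_r}\|\nabla^2 f(q)\|_2\}$, $\alpha_\star:=\min\{r/G,\,2(1-\sigma)/L\}$, and $\underline\alpha:=\min\{\bar\alpha,\rho\alpha_\star\}>0$. Domain-aware Armijo projected gradient method. Input: $p^{(0)}\in C\cap U$, $\bar\alpha>0$, $\sigma,\rho\in(0,1)$, $\varepsilon\ge0$. For $k=0,1,\dots$: (backtracking loop) start with $\alpha:=\bar\alpha$ and repeat: set $q:=P_C(p^{(k)}-\alpha\nabla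 f(p^{(k)}))$; if $q\in U$ and (tested only when $q\in U$) $f(q)\le f(p^{(k)})+\sigma\nabla f(p^{(k)})^\top(q-p^{(k)})$, accept the trial by setting $\alpha_k:=\alpha$, $\tilde p^{(k)}:=q$ and exit the loop; otherwise replace $\alpha$ by $\rho\alpha$ and repeat. After acceptance, if $\|\tilde p^{(k)}-p^{(k)}\|/\alpha_k\le\varepsilon$, terminate and return $p^{(k)}$; otherwise set $p^{(k+1)}:=\tilde p^{(k)}$. *)

(* Defs.v *)
(* R^n is 'rV[R]_n, whose topology (product topology) is the Euclidean one; its
   norm `|x| in MathComp-Analysis is however the sup norm, whence [enorm]. *)
From HB Require Import structures.
From mathcomp Require Import all_boot all_order all_algebra.
From mathcomp Require Import all_classical all_reals all_analysis.

Set Implicit Arguments.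
Unset Strict Implicit.
Unset Printing Implicit Defensive.

Import Order.TTheory GRing.Theory Num.Theory.
Import numFieldNormedType.Exports.

Local Open Scope classical_set_scope.
Local Open Scope ring_scope.

Definition dot {R : realType} {n : nat} (u v : 'rV[R]_n) : R :=
  \sum_(i < n) u 0 i * v 0 i.

Definition enorm {R : realType} {n : nat} (u : 'rV[R]_n) : R :=
  Num.sqrt (dot u u).

(* Operator norm induced by [enorm]; [x *m A^T] is the row vector (A x^T)^T. *)
Definition specnorm {R : realType} {n : nat} (A : 'M[R]_n) : R :=
  sup [set enorm (x *m A^T) | x in [set x : 'rV[R]_n | enorm x <= 1]].

(* Extended-real valued: the infimum is +oo when A or B is empty. *)
Definition edist {R : realType} {n : nat} (A B : set 'rV[R]_n) : \bar R :=
  ereal_inf [set (enorm (a - b))%:E | a in A & b in B].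

(* Meaningful when a unique nearest point exists, e.g. when C is nonempty,
   closed and convex. *)
Definition proj {R : realType} {n : nat} (C : set 'rV[R]_n) (x : 'rV[R]_n) :
    'rV[R]_n :=
  get [set c | C c /\ forall c', C c' -> enorm (x - c) <= enorm (x - c')].

(* A function on an open set U is encoded as a total function; all notions
   below evaluate f and its derivatives at points of U only. *)

Definition grad {R : realType} {n : nat} (f : 'rV[R]_n -> R) (p : 'rV[R]_n) :
    'rV[R]_n :=
  \row_i 'D_(delta_mx 0 i) f p.

Definition hess {R : realType} {n : nat} (f : 'rV[R]_n -> R) (p : 'rV[R]_n) :
    'M[R]_n :=
  \matrix_(i, j) 'D_(delta_mx 0 j) (fun q => 'D_(delta_mx 0 i) f q) p.

Definition twice_continuously_differentiable {R : realType} {n : nat}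
    (U : set 'rV[R]_n) (f : 'rV[R]_n -> R) : Prop :=
  forall p, U p -> [/\ differentiable f p, differentiable (grad f) p
                     & {for p, continuous (hess f)}].

Definition sublevel {R : realType} {n : nat} (C U : set 'rV[R]_n)
    (f : 'rV[R]_n -> R) (a : R) : set 'rV[R]_n :=
  [set p | (C `&` U) p /\ f p <= a].

Definition boundary_blowup {R : realType} {n : nat} (C U : set 'rV[R]_n)
    (f : 'rV[R]_n -> R) : Prop :=
  forall a : R, sublevel C U f a !=set0 ->
    (0 < edist (sublevel C U f a) (~` U))%E.

Definition minimizer {R : realType} {n : nat} (D : set 'rV[R]_n)
    (f : 'rV[R]_n -> R) (x : 'rV[R]_n) : Prop :=
  D x /\ forall y, D y -> f x <= f y.

Definition gradient_mapping {R : realType} {n : nat} (C : set 'rV[R]_n)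
    (f : 'rV[R]_n -> R) (a : R) (p : 'rV[R]_n) : 'rV[R]_n :=
  a^-1 *: (p - proj C (p - a *: grad f p)).

(* [radius], [neighborhood], [grad_bound] and [hess_bound] are r, K_r, G and L.
   The maxima defining G and L are written as suprema: under the hypotheses of
   the theorem they are attained, [sublevel C U f (f p0)] and [neighborhood]
   being compact subsets of U.  The minimum defining r is taken in \bar R, as
   the distance to the complement of U is +oo when U is the whole space. *)

Definition radius {R : realType} {n : nat} (C U : set 'rV[R]_n)
    (f : 'rV[R]_n -> R) (p0 : 'rV[R]_n) : R :=
  fine (Order.min 1%E (edist (sublevel C U f (f p0)) (~` U) * (2^-1)%:E)%E).

Definition neighborhood {R : realType} {n : nat} (C U : set 'rV[R]_n)
    (f : 'rV[R]_n -> R) (p0 : 'rV[R]_n) : set 'rV[R]_n :=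
  [set q | (edist [set q] (sublevel C U f (f p0)) <= (radius C U f p0)%:E)%E].

Definition grad_bound {R : realType} {n : nat} (C U : set 'rV[R]_n)
    (f : 'rV[R]_n -> R) (p0 : 'rV[R]_n) : R :=
  Num.max 1 (sup [set enorm (grad f p) | p in sublevel C U f (f p0)]).

Definition hess_bound {R : realType} {n : nat} (C U : set 'rV[R]_n)
    (f : 'rV[R]_n -> R) (p0 : 'rV[R]_n) : R :=
  Num.max 1 (sup [set specnorm (hess f q) | q in neighborhood C U f p0]).

Definition alpha_star {R : realType} {n : nat} (C U : set 'rV[R]_n)
    (f : 'rV[R]_n -> R) (sigma : R) (p0 : 'rV[R]_n) : R :=
  Num.min (radius C U f p0 / grad_bound C U f p0)
          (2 * (1 - sigma) / hess_bound C U f p0).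

Definition alpha_low {R : realType} {n : nat} (C U : set 'rV[R]_n)
    (f : 'rV[R]_n -> R) (abar sigma rho : R) (p0 : 'rV[R]_n) : R :=
  Num.min abar (rho * alpha_star C U f sigma p0).

Definition trial {R : realType} {n : nat} (C : set 'rV[R]_n)
    (f : 'rV[R]_n -> R) (p : 'rV[R]_n) (a : R) : 'rV[R]_n :=
  proj C (p - a *: grad f p).

Definition accepted {R : realType} {n : nat} (C U : set 'rV[R]_n)
    (f : 'rV[R]_n -> R) (sigma : R) (p : 'rV[R]_n) (a : R) : Prop :=
  let q := trial C f p a in
  U q /\ f q <= f p + sigma * dot (grad f p) (q - p).

(* [backtracking C U f sigma rho p a b]: the backtracking loop at p, entered
   with step size a, terminates and accepts the step size b. *)
Inductive backtracking {R : realType} {n : nat} (C U : set 'rV[R]_n)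
    (f : 'rV[R]_n -> R) (sigma rho : R) (p : 'rV[R]_n) : R -> R -> Prop :=
| backtracking_accept (a : R) :
    accepted C U f sigma p a -> backtracking C U f sigma rho p a a
| backtracking_reject (a b : R) :
    ~ accepted C U f sigma p a ->
    backtracking C U f sigma rho p (rho * a) b ->
    backtracking C U f sigma rho p a b.

(* The method started at p0 generates the iterates p 0, ..., p N, with accepted
   step sizes alpha 0, ..., alpha N.-1, without having terminated at any of
   p 0, ..., p N.-1; the other values of p and alpha are unconstrained. *)
Definition generated {R : realType} {n : nat} (C U : set 'rV[R]_n)
    (f : 'rV[R]_n -> R) (abar sigma rho eps : R) (p0 : 'rV[R]_n)
    (p : nat -> 'rV[R]_n) (alpha : nat -> R) (N : nat) : Prop :=
  p 0%N = p0 /\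
  forall k : nat, (k < N)%N ->
    [/\ backtracking C U f sigma rho (p k) abar (alpha k),
        ~ (enorm (trial C f (p k) (alpha k) - p k) / alpha k <= eps)
      & p k.+1 = trial C f (p k) (alpha k)].

(* Main.v *)
Require Import Defs.
From HB Require Import structures.
From mathcomp Require Import all_boot all_order all_algebra.
From mathcomp Require Import all_classical all_reals all_analysis.
From mathcomp Require Import ring lra.

(** Everything rests on the variational inequality of the projection
    ([proj_obtuse]): if [q] is the projection of [x] onto [C], then
    [dot (x - q) (c - q) <= 0] for all [c] in [C].  For a trial step
    [q = P_C (p - a grad f p)] it is used twice.

    With [c = p] it gives [a * dot (grad f p) (q - p) <= - enorm (q - p) ^+ 2]
    ([trial_descent]).  Together with the Armijo test, an accepted step lowers
    [f] by at least [sigma * a * enorm (G_a p) ^+ 2]; summing over the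
    iterations bounds the sum of the squared gradient mappings by
    [(f p0 - f pstar) / (sigma * a_low)], where [a_low] is a lower bound of the
    accepted steps.  The bound on the minimum, the bound on the series and the
    convergence to 0 are consequences.

    With [c = pstar] and the gradient inequality of the convex function [f]
    ([convex_gradient_le]) it shows that [2 a_k (f (p k) - f pstar)] is at most
    the decrease of the squared distance to [pstar] plus
    [2 abar / sigma * (f (p k) - f (p k.+1))] ([distance_decrease]); this sum
    telescopes, and [f (p K)] is the smallest of the values summed.

    There remains the lower bound on the steps: every trial step
    [a <= alpha_star] from the initial sublevel set is accepted
    ([accepted_small]), so backtracking never goes below the
    minimum of [abar] and [rho * alpha_star].
    By the blow-up hypothesis that sublevel set is compact and at positive
    distance from the complement of [U]; its closed [r]-neighbourhood is then a
    compact subset of [U], on which the Hessian is bounded by some [L].  The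
    inequality [a <= r / G] keeps the segment from [p] to [q] inside this
    neighbourhood, so that the quadratic upper bound of [f] ([descent_lemma])
    applies, and [a <= 2 (1 - sigma) / L] turns it into the Armijo test. *)

Set Implicit Arguments.
Unset Strict Implicit.
Unset Printing Implicit Defensive.

Import Order.TTheory GRing.Theory Num.Theory.
Import numFieldNormedType.Exports.

Local Open Scope classical_set_scope.
Local Open Scope ring_scope.

(** * Euclidean inner product and norm *)

Section Euclid.
Context {R : realType} {n : nat}.
Implicit Types (u v w x y : 'rV[R]_n) (a : R).

Lemma dotC u v : dot u v = dot v u.
Proof. by apply: eq_bigr => i _; rewrite mulrC. Qed.

Lemma dotDl u v w : dot (u + v) w = dot u w + dot v w.
Proof. by rewrite -big_split; apply: eq_bigr => i _; rewrite !mxE mulrDl. Qed.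

Lemma dotZl a u v : dot (a *: u) v = a * dot u v.
Proof. by rewrite mulr_sumr; apply: eq_bigr => i _; rewrite !mxE mulrA. Qed.

Lemma dotDr u v w : dot u (v + w) = dot u v + dot u w.
Proof. by rewrite dotC dotDl !(dotC u). Qed.

Lemma dotZr a u v : dot u (a *: v) = a * dot u v.
Proof. by rewrite dotC dotZl (dotC u). Qed.

Lemma dotNl u v : dot (- u) v = - dot u v.
Proof. by rewrite -scaleN1r dotZl mulN1r. Qed.

Lemma dotNr u v : dot u (- v) = - dot u v.
Proof. by rewrite dotC dotNl (dotC u). Qed.

Lemma dot0l u : dot 0 u = 0.
Proof. by rewrite -(scale0r 0) dotZl mul0r. Qed.

Definition dotE := (dotDl, dotDr, dotNl, dotNr, dotZl, dotZr).

Lemma dot_ge0 u : 0 <= dot u u.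
Proof. by apply: sumr_ge0 => i _; rewrite -expr2 sqr_ge0. Qed.

Lemma enorm_ge0 u : 0 <= enorm u.
Proof. exact: sqrtr_ge0. Qed.

Lemma enorm_sq u : enorm u ^+ 2 = dot u u.
Proof. by rewrite sqr_sqrtr// dot_ge0. Qed.

Lemma coord_le_enorm u i : `|u 0 i| <= enorm u.
Proof.
rewrite -sqrtr_sqr ler_wsqrtr// expr2 /dot (bigD1 i)//= lerDl.
by apply: sumr_ge0 => j _; rewrite -expr2 sqr_ge0.
Qed.

(** Here [`|u|] is the sup norm, in terms of which bounded sets are defined. *)
Lemma norm_le_enorm u : `|u| <= enorm u.
Proof.
rewrite [leLHS]/Num.Def.normr/= mx_normrE; apply: bigmax_le => [|[i j] _].
  exact: enorm_ge0.
by rewrite ord1 coord_le_enorm.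
Qed.

Lemma enorm_eq0 u : enorm u = 0 -> u = 0.
Proof.
move=> u0; apply/rowP => i; rewrite mxE; apply/eqP; rewrite -normr_le0 -u0.
exact: coord_le_enorm.
Qed.

Lemma enorm0 : enorm (0 : 'rV[R]_n) = 0.
Proof. by rewrite /enorm dot0l sqrtr0. Qed.

Lemma enormZ a u : enorm (a *: u) = `|a| * enorm u.
Proof.
by rewrite /enorm dotZl dotZr mulrA -expr2 sqrtrM ?sqr_ge0// sqrtr_sqr.
Qed.

Lemma enormN u : enorm (- u) = enorm u.
Proof. by rewrite -scaleN1r enormZ normrN1 mul1r. Qed.

Lemma enorm_distC u v : enorm (u - v) = enorm (v - u).
Proof. by rewrite -enormN opprB. Qed.

(** Cauchy-Schwarz, read off from [0 <= dot w w] for [w] the vector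
    [enorm v *: u - enorm u *: v]. *)
Lemma dot_le_enorm u v : dot u v <= enorm u * enorm v.
Proof.
have [/enorm_eq0->|u0] := eqVneq (enorm u) 0; first by rewrite dot0l enorm0 mul0r.
have [/enorm_eq0->|v0] := eqVneq (enorm v) 0.
  by rewrite dotC dot0l enorm0 mulr0.
have up : 0 < enorm u by rewrite lt_def u0 enorm_ge0.
have vp : 0 < enorm v by rewrite lt_def v0 enorm_ge0.
have := dot_ge0 (enorm v *: u - enorm u *: v).
rewrite !dotE -!enorm_sq (dotC v u).
rewrite [X in 0 <= X](_ : _ =
  2 * (enorm u * enorm v) * (enorm u * enorm v - dot u v)); last by ring.
by rewrite pmulr_rge0 ?subr_ge0// mulr_gt0// mulr_gt0.
Qed.

Lemma enorm_triangle u v : enorm (u + v) <= enorm u + enorm v.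
Proof.
have h : 0 <= enorm u + enorm v by rewrite addr_ge0// enorm_ge0.
rewrite -(ler_pXn2r (n := 2))// ?nnegrE ?enorm_ge0//.
rewrite enorm_sq !dotE -!enorm_sq (dotC v u).
have := dot_le_enorm u v; nra.
Qed.

Lemma dot_self_continuous : continuous (fun u : 'rV[R]_n => dot u u).
Proof.
apply: continuous_big => [|i _ x]; first exact: add_continuous.
by apply: (@continuousM _ _ _ _ x); exact: coord_continuous.
Qed.

Lemma enorm_continuous : continuous (@enorm R n).
Proof.
move=> x.
apply: (@continuous_comp _ _ _ (fun u : 'rV[R]_n => dot u u) (@Num.sqrt R)).
  exact: dot_self_continuous.
exact: sqrt_continuous.
Qed.

Lemma dist_continuous x : continuous (fun y => enorm (x - y)).
Proof.
move=> y; apply: (@continuous_comp _ _ _ (fun y => x - y) (@enorm R n)).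
  by apply: continuousB => //; exact: cst_continuous.
exact: enorm_continuous.
Qed.

Lemma near_enorm (x : 'rV[R]_n) (e : R) : 0 < e ->
  \forall y \near x, enorm (x - y) < e.
Proof.
move=> e0.
have := @dist_continuous x x.
by rewrite /continuous_at subrr enorm0 => /cvgr_lt; exact.
Qed.

End Euclid.

(** * Projection onto a compact convex set *)

Lemma convex_segment (R : realType) (n : nat) (A : set 'rV[R]_n)
    (x y : 'rV[R]_n) (t : R) :
  @convex_set R 'rV[R]_n A -> A x -> A y -> 0 <= t -> t <= 1 ->
  A (x + t *: (y - x)).
Proof.
move=> cA Ax Ay t0 t1.
have /set_mem := cA y x (Itv01 t0 t1) (mem_set Ay) (mem_set Ax).
have -> // : x + t *: (y - x) = t *: y + (1 - t) *: x.
by rewrite scalerBr scalerBl scale1r addrCA.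
Qed.

Section Projection.
Context {R : realType} {n : nat}.
Variable C : set 'rV[R]_n.
Hypothesis C_nonempty : C !=set0.
Hypothesis C_compact : compact C.

Lemma projP (x : 'rV[R]_n) :
  C (Defs.proj C x) /\ forall c, C c -> enorm (x - Defs.proj C x) <= enorm (x - c).
Proof.
have [|c /set_mem Cc cmin] :=
    @EVT_min_rV R n (fun c => enorm (x - c)) C C_nonempty C_compact.
  exact/continuous_subspaceT/dist_continuous.
have ex : exists c, C c /\ forall c', C c' -> enorm (x - c) <= enorm (x - c').
  by exists c; split => // c' Cc'; apply: cmin; exact: mem_set.
exact: (xgetPex _ ex).
Qed.

Lemma proj_in (x : 'rV[R]_n) : C (Defs.proj C x).
Proof. by have [] := projP x. Qed.

Hypothesis C_convex : @convex_set R 'rV[R]_n C.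

(** Moving from the projection [q] towards [c] by a small [t] stays inside the
    convex set [C] and changes the squared distance to [x] by
    [- 2 t dot (x - q) (c - q) + O(t^2)], which has to be nonnegative. *)
Lemma proj_obtuse (x c : 'rV[R]_n) : C c ->
  dot (x - Defs.proj C x) (c - Defs.proj C x) <= 0.
Proof.
move=> Cc; have [] := projP x; set q := Defs.proj C x => Cq qmin.
set S := dot _ _; set N := dot (c - q) (c - q).
have key t : 0 < t -> t <= 1 -> 2 * S <= t * N.
  move=> t0 t1; have := qmin _ (convex_segment C_convex Cq Cc (ltW t0) t1).
  rewrite -(ler_pXn2r (n := 2))// ?nnegrE ?enorm_ge0// !enorm_sq.
  have -> : dot (x - (q + t *: (c - q))) (x - (q + t *: (c - q))) =
      dot (x - q) (x - q) + t * (t * N - 2 * S).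
    rewrite opprD addrA /S /N; move: (x - q) (c - q) => u v.
    by rewrite !dotE (dotC v u); ring.
  by rewrite lerDl pmulr_rge0// subr_ge0.
have N0 : 0 <= N by exact: dot_ge0.
have [//|S0] := leP S 0.
have N1 : 2 * S <= N by have := key 1 ltr01 (lexx _); rewrite mul1r.
have Npos : 0 < N by lra.
(* This [t] makes [t * N] equal to [S], hence smaller than [2 * S]. *)
have := key (S / N); rewrite divfK ?gt_eqF//.
move=> /(_ (divr_gt0 S0 Npos)); rewrite ler_pdivrMr// mul1r.
by move=> /(_ ltac:(lra)); lra.
Qed.

End Projection.

(** * Differential calculus along lines *)

Section Calculus.
Context {R : realType} {n : nat}.
Implicit Types (f : 'rV[R]_n -> R) (p q v x y : 'rV[R]_n).

Lemma derive_grad f p v : differentiable f p -> 'D_v f p = dot (grad f p) v.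
Proof.
move=> df; rewrite deriveE// {1}(row_sum_delta v) linear_sum.
apply: eq_bigr => i _; rewrite linearZ mxE deriveE// mulrC; exact.
Qed.

Lemma is_derive_line (V : normedModType R) (g : 'rV[R]_n -> V) x v (t : R) :
  differentiable g (x + t *: v) ->
  is_derive t 1 (fun s : R => g (x + s *: v)) ('D_v g (x + t *: v)).
Proof.
move=> dg.
have E : (fun h : R => h^-1 *:
      (((fun s : R => g (x + s *: v)) \o shift t) (h *: (1 : R))
    - g (x + t *: v))) = (fun h => h^-1 *: ((g \o shift (x + t *: v)) (h *: v)
    - g (x + t *: v))).
  apply/funext => h /=; do 3 congr (_ _).
  by rewrite [h *: 1]mulr1 scalerDl addrCA.
split; rewrite /derivable /derive E //.
exact: diff_derivable.
Qed.

(** The difference quotients [(f (x + t (y - x)) - f x) / t] with [0 < t <= 1]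
    are bounded by [f y - f x] by convexity; let [t] tend to 0 from the
    right. *)
Lemma convex_gradient_le (D : set 'rV[R]_n) f x y :
  @convex_function R 'rV[R]_n D f -> D x -> D y -> differentiable f x ->
  dot (grad f x) (y - x) <= f y - f x.
Proof.
move=> cf Dx Dy df; rewrite -derive_grad//.
pose phi (h : R) : R := h^-1 * (f (h *: (y - x) + x) - f x).
have phi_cvg : phi @ (0 : R)^'+ --> 'D_(y - x) f x.
  have dv : derivable f x (y - x) by exact: diff_derivable.
  have right_sub : (0 : R)^'+ `=>` (0 : R)^'.
    move=> A; rewrite /at_right /dnbhs /within /=; apply: filterS => z Az z0.
    by apply: Az; rewrite gt_eqF.
  by apply: cvg_trans dv => A; exact: right_sub.
apply: (cvgr_to_le phi_cvg).
near=> t.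
have t0 : 0 < t by near: t; exact: nbhs_right_gt.
have t1 : t <= 1 by near: t; apply: nbhs_right_le.
have := cf (Itv01 (ltW t0) t1) y x (mem_set Dy) (mem_set Dx).
change (f (t *: y + (1 - t) *: x) <= t * f y + (1 - t) * f x ->
  phi t <= f y - f x); rewrite /phi.
have -> : t *: y + (1 - t) *: x = t *: (y - x) + x.
  by rewrite scalerBl scalerBr scale1r addrA addrAC.
rewrite ler_pdivrMl// => h; lra.
Unshelve. all: by end_near. Qed.

Lemma derive_gradient f p v : differentiable (grad f) p ->
  'D_v (grad f) p = v *m (hess f p)^T.
Proof.
move=> dg; rewrite derive_mx; last exact: diff_derivable.
apply/rowP => i; rewrite !mxE.
have E : (fun q => grad f q 0 i) = 'D_(delta_mx 0 i) f.
  by apply/funext => q; rewrite mxE.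
rewrite derive_grad; last first.
  apply: (@differentiable_comp _ _ _ _ (grad f) (fun M : 'rV[R]_n => M 0 i)) => //.
  exact: differentiable_coord.
by rewrite dotC; apply: eq_bigr => j _; rewrite !mxE E.
Qed.

Lemma dot_derive (g : R -> 'rV[R]_n) (t : R) dg v : is_derive t 1 g dg ->
  is_derive t 1 (fun s => dot (g s) v) (dot dg v).
Proof.
move=> [gd <-].
have -> : (fun s => dot (g s) v) = \sum_(i < n) (fun s => v 0 i *: g s 0 i).
  by apply/funext => s; rewrite fct_sumE; apply: eq_bigr => i _; rewrite mulrC.
rewrite derive_mx// /dot; apply: is_derive_eq.
  apply: is_derive_sum => i; apply: is_deriveZ.
  by apply: derivableP; move/derivable_mxP : gd => /(_ 0 i).
by apply: eq_bigr => i _; rewrite mxE mulrC.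
Qed.

(** Taylor's inequality of order 2 along a segment.  A bound on the second
    derivative of [t |-> f (x + t v)] gives, by the mean value theorem, an
    affine bound on the first one; a second application of the theorem, to
    the function minus its quadratic upper bound, concludes. *)
Lemma descent_lemma f x v (L : R) :
  (forall t : R, 0 <= t <= 1 ->
    [/\ differentiable f (x + t *: v), differentiable (grad f) (x + t *: v)
      & dot (v *m (hess f (x + t *: v))^T) v <= L * dot v v]) ->
  f (x + v) <= f x + dot (grad f x) v + L / 2 * dot v v.
Proof.
move=> H.
pose N := dot v v.
pose g s := f (x + s *: v).
pose g' s := dot (grad f (x + s *: v)) v.
pose g'' s := dot (v *m (hess f (x + s *: v))^T) v.
have d1 (t : R) : 0 <= t <= 1 -> is_derive t 1 g (g' t).
  by move=> /H[df _ _]; rewrite /g' -derive_grad//; exact: is_derive_line.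
have d2 (t : R) : 0 <= t <= 1 -> is_derive t 1 g' (g'' t).
  move=> /H[_ dg _]; have := dot_derive v (is_derive_line dg).
  by rewrite derive_gradient.
have g'_le (t : R) : 0 <= t <= 1 -> g' t <= g' 0 + L * N * t.
  move=> /andP[t0 t1].
  have [||c cI] := @MVT_segment R g' g'' 0 t t0.
  - move=> s; rewrite in_itv/= => /andP[s0 st].
    by apply: d2; rewrite ltW//= (le_trans (ltW st)).
  - apply: continuous_in_subspaceT => s /set_mem/=; rewrite in_itv/= => /andP[s0 st].
    apply: differentiable_continuous; apply/derivable1_diffP.
    by apply: ex_derive; apply: d2; rewrite s0 (le_trans st).
  move: cI; rewrite in_itv/= subr0 => /andP[c0 ct] E.
  have [|_ _ Hc] := H c; first by rewrite c0 (le_trans ct).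
  by rewrite -lerBlDl E ler_wpM2r.
pose h s := g s - g' 0 * s - L / 2 * N * s ^+ 2.
have dh (t : R) : 0 <= t <= 1 -> is_derive t 1 h (g' t - g' 0 - L * N * t).
  move=> t01; have := d1 t t01 => dg.
  rewrite /h; apply: is_derive_eq.
  by rewrite /GRing.scale/=; field.
have [||c cI] := @MVT_segment R h (fun t => g' t - g' 0 - L * N * t) 0 1 ler01.
- by move=> s; rewrite in_itv/= => /andP[s0 s1]; apply: dh; rewrite !ltW.
- apply: continuous_in_subspaceT => s /set_mem/=; rewrite in_itv/= => sI.
  apply: differentiable_continuous; apply/derivable1_diffP.
  by apply: ex_derive; exact: dh.
move: cI; rewrite in_itv/= => /g'_le cle.
have g0 : g 0 = f x by rewrite /g scale0r addr0.
have g1 : g 1 = f (x + v) by rewrite /g scale1r.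
have g'0 : g' 0 = dot (grad f x) v by rewrite /g' scale0r addr0.
rewrite /h g0 g1 g'0 !mulr0 !mulr1 expr0n expr1n mulr0 mulr1 !subr0 mulr1 -/N.
lra.
Qed.

(** * Spectral norm *)

(** The Frobenius norm bounds the operator norm: Cauchy-Schwarz on each row.
    It is what shows that the suprema defining the spectral norm and the
    Hessian bound are finite. *)
Lemma enorm_mulmx_le (A : 'M[R]_n) x :
  enorm (x *m A^T) <= Num.sqrt (\sum_i dot (row i A) (row i A)) * enorm x.
Proof.
rewrite /enorm -sqrtrM ?sumr_ge0// => [|i _]; last exact: dot_ge0.
apply: ler_wsqrtr; rewrite mulr_suml {1}/dot; apply: ler_sum => i _.
have -> : (x *m A^T) 0 i = dot (row i A) x.
  by rewrite mxE; apply: eq_bigr => j _; rewrite !mxE mulrC.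
have h := dot_le_enorm (row i A) x.
have h2 := dot_le_enorm (- row i A) x.
rewrite dotNl enormN in h2.
rewrite -!enorm_sq -exprMn -expr2 -ler_sqrt ?sqr_ge0//.
rewrite !sqrtr_sqr (ger0_norm (mulr_ge0 _ _)) ?enorm_ge0// ler_norml h andbT.
by rewrite lerNl.
Qed.

Lemma has_sup_specnorm (A : 'M[R]_n) :
  has_sup [set enorm (x *m A^T) | x in [set x : 'rV[R]_n | enorm x <= 1]].
Proof.
split; first by exists (enorm (0 *m A^T)), 0 => //=; rewrite enorm0.
exists (Num.sqrt (\sum_i dot (row i A) (row i A))) => _ [x /= x1 <-].
by rewrite (le_trans (enorm_mulmx_le _ _))// ler_piMr.
Qed.

Lemma specnorm_le (A : 'M[R]_n) (c : R) :
  (forall x, enorm x <= 1 -> enorm (x *m A^T) <= c) -> specnorm A <= c.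
Proof.
move=> H; apply: ge_sup; first by have [] := has_sup_specnorm A.
by move=> _ [x /= x1 <-]; exact: H.
Qed.

Lemma enorm_mulmx_specnorm (A : 'M[R]_n) x :
  enorm (x *m A^T) <= specnorm A * enorm x.
Proof.
have [/enorm_eq0->|x0] := eqVneq (enorm x) 0.
  by rewrite mul0mx enorm0 mulr0.
have xp : 0 < enorm x by rewrite lt_def x0 enorm_ge0.
rewrite -ler_pdivrMr// mulrC -[X in X * _]ger0_norm ?invr_ge0 ?enorm_ge0//.
rewrite -enormZ scalemxAl; apply: ub_le_sup; first by have [] := has_sup_specnorm A.
exists ((enorm x)^-1 *: x) => //=.
by rewrite enormZ ger0_norm ?invr_ge0 ?enorm_ge0// mulVf.
Qed.

Lemma quadform_le_specnorm (A : 'M[R]_n) v :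
  dot (v *m A^T) v <= specnorm A * dot v v.
Proof.
rewrite (le_trans (dot_le_enorm _ _))// -enorm_sq expr2 mulrA.
by rewrite ler_wpM2r ?enorm_ge0// enorm_mulmx_specnorm.
Qed.

Lemma specnorm_has_ubound (K : set 'rV[R]_n) (H : 'rV[R]_n -> 'M[R]_n) :
  compact K -> (forall q, K q -> {for q, continuous H}) ->
  has_ubound [set specnorm (H q) | q in K].
Proof.
move=> cK cH.
have : compact (H @` K).
  apply: continuous_compact => //; apply: continuous_in_subspaceT.
  by move=> q /set_mem; exact: cH.
move=> /compact_bounded[M [_ /(_ (M + 1))]]; rewrite ltrDl => /(_ ltr01) HM.
exists (Num.sqrt (\sum_(i < n) \sum_(j < n) (M + 1) ^+ 2)) => _ [q Kq <-].
have M0 : 0 <= M + 1 by apply: le_trans (HM (H q) _) => //; exists q.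
apply: specnorm_le => x x1.
apply: (le_trans (enorm_mulmx_le _ _)); rewrite -[leRHS]mulr1.
apply: ler_pM => //; rewrite ?sqrtr_ge0 ?enorm_ge0//; apply: ler_wsqrtr.
apply: ler_sum => i _; apply: ler_sum => j _; rewrite !mxE -expr2.
rewrite -ler_sqrt ?sqr_ge0// !sqrtr_sqr (ger0_norm M0).
apply: le_trans (HM (H q) _); last by exists q.
rewrite [leRHS]/Num.Def.normr/= mx_normrE.
exact: (le_trans _ (@le_bigmax _ _ _ _ (fun x : 'I_n * 'I_n => `|H q x.1 x.2|) (i, j))).
Qed.

End Calculus.

(** * The initial sublevel set and its neighbourhood *)

Section Sets.
Context {R : realType} {n : nat}.
Implicit Types (A B K : set 'rV[R]_n) (p q : 'rV[R]_n).

Lemma set_dist_le A B p q : A p -> B q -> (Defs.edist A B <= (enorm (p - q))%:E)%E.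
Proof. by move=> Ap Bq; apply: ereal_inf_lbound; exists p => //; exists q. Qed.

Lemma set_dist_ge0 A B : (0 <= Defs.edist A B)%E.
Proof. by apply: le_ereal_inf_tmp => _ [a _ [b _ <-]]; rewrite lee_fin enorm_ge0. Qed.

Lemma point_dist_lt q B (e : R) : (Defs.edist [set q] B < e%:E)%E ->
  exists2 b, B b & enorm (q - b) < e.
Proof. by move=> /ereal_inf_lt[_ [_ -> [b Bb <-]]]; rewrite lte_fin; exists b. Qed.

(** The distance to a set is 1-Lipschitz, hence continuous. *)
Lemma closed_thickening B (r : R) :
  closed [set q | (Defs.edist [set q] B <= r%:E)%E].
Proof.
move=> q clq /=; apply/lee_addgt0Pr => e e0; rewrite -EFinD.
have e20 : 0 < e / 2 by rewrite divr_gt0.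
have [q' [/= q'K qq']] := clq _ (near_enorm q e20).
have [|b Bb q'b] := @point_dist_lt q' B (r + e / 2).
  by rewrite (le_lt_trans q'K)// lte_fin ltrDl.
apply: (le_trans (set_dist_le (erefl q) Bb)); rewrite lee_fin.
have := enorm_triangle (q - q') (q' - b); rewrite subrKA; lra.
Qed.

Lemma bounded_thickening B (r : R) : bounded_set B ->
  bounded_set [set q | (Defs.edist [set q] B <= r%:E)%E].
Proof.
move=> [M [_ /(_ (M + 1))]]; rewrite ltrDl => /(_ ltr01) BM.
exists (M + 1 + (r + 1)); split; first exact: num_real.
move=> c cM q /= qK.
have [|b Bb qb] := @point_dist_lt q B (r + 1).
  by rewrite (le_lt_trans qK)// lte_fin ltrDl.
rewrite -(subrK b q) (le_trans (ler_normD _ _))//.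
have /= := BM _ Bb; have := norm_le_enorm (q - b); lra.
Qed.

Variables (C U : set 'rV[R]_n) (f : 'rV[R]_n -> R) (p0 : 'rV[R]_n).
Hypothesis C_compact : compact C.
Hypothesis f_C2 : twice_continuously_differentiable U f.
Hypothesis f_blowup : boundary_blowup C U f.
Hypothesis p0_CU : (C `&` U) p0.

Let F0 := sublevel C U f (f p0).

Let F0p0 : F0 p0. Proof. by split. Qed.

Let dist_gt0 : (0 < Defs.edist F0 (~` U))%E.
Proof. by apply: f_blowup; exists p0. Qed.

(** The blow-up hypothesis makes the sublevel set closed: limits of its points
    stay in [U], where [f] is continuous. *)
Lemma sublevel_compact : compact F0.
Proof.
apply: (subclosed_compact _ C_compact); last by move=> x [[]].
move=> x clx.
have Cx : C x.
  apply: (compact_closed (@norm_hausdorff _ _) C_compact).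
  by apply: closure_subset clx => y [[]].
have Ux : U x.
  apply: contrapT => nUx.
  have [e e0 eF] : exists2 e : R, 0 < e & forall y, F0 y -> e <= enorm (x - y).
    have : Defs.edist F0 (~` U) \is a fin_num.
      rewrite ge0_fin_numE ?set_dist_ge0//.
      exact: (le_lt_trans (set_dist_le F0p0 nUx) (ltry _)).
    move=> /fineK fE; exists (fine (Defs.edist F0 (~` U))).
      by rewrite -lte_fin fE.
    by move=> y Fy; rewrite -lee_fin fE enorm_distC; exact: set_dist_le.
  have [y [/eF ey xy]] := clx _ (near_enorm x e0).
  by move: xy; rewrite /= ltNge ey.
split=> //; rewrite leNgt; apply/negP => fx.
have [df _ _] := f_C2 Ux.
have [y [[_ fy]]] := clx _ (cvgr_gt _ (differentiable_continuous df) _ fx).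
by rewrite /= ltNge fy.
Qed.

Let r := Defs.radius C U f p0.

Lemma radius_gt0 : 0 < r.
Proof.
rewrite /r /Defs.radius -/F0; case: (Defs.edist F0 (~` U)) dist_gt0 => [d| |]//.
- rewrite lte_fin => d0; rewrite -EFinM.
  by rewrite -EFin_min /= lt_min ltr01 mulr_gt0.
- by move=> _; rewrite gt0_mulye ?lte_fin// /Order.min ltry.
Qed.

(** The factor 1/2 in the radius is what makes this inequality strict. *)
Lemma radius_lt_edist : (r%:E < Defs.edist F0 (~` U))%E.
Proof.
rewrite /r /Defs.radius -/F0; case: (Defs.edist F0 (~` U)) dist_gt0 => [d| |]//.
- rewrite lte_fin => d0; rewrite -EFinM -EFin_min /= lte_fin.
  by rewrite gt_min ltr_pdivrMr// mulr_natr mulr2n ltrDl d0 orbT.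
- by move=> _; rewrite ltry.
Qed.

Lemma neighborhood_sub : neighborhood C U f p0 `<=` U.
Proof.
move=> q /= qK; apply: contrapT => nUq.
have := radius_lt_edist; case E : (Defs.edist F0 (~` U)) => [d| |] // rd.
- have [b Fb qb] := point_dist_lt (le_lt_trans qK rd).
  by have := @set_dist_le F0 (~` U) b q Fb nUq; rewrite E lee_fin enorm_distC leNgt qb.
- by have := @set_dist_le F0 (~` U) p0 q F0p0 nUq; rewrite E.
Qed.

Lemma neighborhood_compact : compact (neighborhood C U f p0).
Proof.
apply: bounded_closed_compact; last exact: closed_thickening.
exact/bounded_thickening/compact_bounded/sublevel_compact.
Qed.

Lemma neighborhood_ball p q : F0 p -> enorm (q - p) <= r ->
  neighborhood C U f p0 q.
Proof.
by move=> Fp qp; apply: (le_trans (set_dist_le (erefl q) Fp)); rewrite lee_fin.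
Qed.

Lemma grad_bound_ge1 : 1 <= grad_bound C U f p0.
Proof. by rewrite le_max lexx. Qed.

Lemma hess_bound_ge1 : 1 <= hess_bound C U f p0.
Proof. by rewrite le_max lexx. Qed.

Lemma grad_le_bound p : F0 p -> enorm (grad f p) <= grad_bound C U f p0.
Proof.
move=> Fp; rewrite le_max; apply/orP; right.
apply: ub_le_sup; last by exists p.
have : compact [set enorm (grad f p) | p in F0].
  apply: continuous_compact; last exact: sublevel_compact.
  apply: continuous_in_subspaceT => q /set_mem[[_ /f_C2[_ dg _]] _].
  apply: (@continuous_comp _ _ _ (grad f) (@enorm R n)).
    exact: differentiable_continuous.
  exact: enorm_continuous.
by move=> /compact_has_sup[|//]; exists (enorm (grad f p)), p.
Qed.

Lemma specnorm_le_bound q : neighborhood C U f p0 q ->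
  specnorm (hess f q) <= hess_bound C U f p0.
Proof.
move=> Kq; rewrite le_max; apply/orP; right.
apply: ub_le_sup; last by exists q.
apply: specnorm_has_ubound; first exact: neighborhood_compact.
by move=> x /neighborhood_sub/f_C2[].
Qed.

Lemma alpha_star_gt0 (sigma : R) : sigma < 1 -> 0 < alpha_star C U f sigma p0.
Proof.
move=> s1; have := grad_bound_ge1; have := hess_bound_ge1 => h g.
by rewrite lt_min !divr_gt0 ?radius_gt0 ?(lt_le_trans ltr01 g)
  ?(lt_le_trans ltr01 h) ?mulr_gt0 ?subr_gt0.
Qed.

(** * Acceptance of short steps *)

Hypothesis C_convex : @convex_set R 'rV[R]_n C.

(** This is [proj_obtuse] at the point [p] of [C]. *)
Lemma trial_descent p (a : R) : C p ->
  a * dot (grad f p) (trial C f p a - p) <= - enorm (trial C f p a - p) ^+ 2.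
Proof.
move=> Cp; have C0 : C !=set0 by exists p.
have := proj_obtuse C0 C_compact C_convex (p - a *: grad f p) Cp.
rewrite -/(trial C f p a); move: (trial C f p a) => q.
rewrite enorm_sq (_ : p - _ - q = - (q - p) - a *: grad f p); last first.
  by rewrite opprB addrAC.
rewrite -(opprB q p); move: (q - p) => d.
by rewrite !dotE opprK; lra.
Qed.

(** Cauchy-Schwarz applied to [trial_descent], divided by the length of the
    step. *)
Lemma trial_dist p (a : R) : C p -> 0 < a ->
  enorm (trial C f p a - p) <= a * enorm (grad f p).
Proof.
move=> Cp a0; have := trial_descent a Cp; move: (_ - p) => d h.
have := dot_le_enorm (- grad f p) d; rewrite dotNl enormN => cs.
have [->|d0] := eqVneq (enorm d) 0; first by rewrite mulr_ge0 ?enorm_ge0// ltW.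
have dp : 0 < enorm d by rewrite lt_def d0 enorm_ge0.
rewrite -(ler_pM2r dp) -expr2; nra.
Qed.

(** By [trial_dist], a step with [a <= r / G] has length at most [r], so the
    segment from [p] to the trial point lies in the neighbourhood where the
    Hessian is bounded by [L].  There [descent_lemma] applies, and
    [trial_descent] reduces the Armijo test to [a * L <= 2 (1 - sigma)]. *)
Lemma accepted_small (sigma : R) p (a : R) : F0 p -> 0 < a ->
  a <= alpha_star C U f sigma p0 -> accepted C U f sigma p a.
Proof.
move=> Fp a0; rewrite le_min => /andP[aG aL].
have Cp : C p by case: Fp => -[].
have L0 : 0 < hess_bound C U f p0 by apply: lt_le_trans hess_bound_ge1.
have G0 : 0 < grad_bound C U f p0 by apply: lt_le_trans grad_bound_ge1.
rewrite ler_pdivlMr// in aG; rewrite ler_pdivlMr// in aL.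
have hd := trial_descent a Cp; have hl := trial_dist Cp a0.
rewrite /accepted; move: hd hl; set q := trial C f p a => hd hl.
have qr : enorm (q - p) <= r.
  apply: le_trans hl (le_trans _ aG).
  by rewrite ler_wpM2l ?(ltW a0)// grad_le_bound.
have seg (t : R) : 0 <= t <= 1 -> neighborhood C U f p0 (p + t *: (q - p)).
  move=> /andP[t0 t1]; apply: (neighborhood_ball Fp).
  rewrite addrAC subrr add0r enormZ ger0_norm// (le_trans _ qr)//.
  by rewrite ler_piMl ?enorm_ge0.
have taylor := @descent_lemma R n f p (q - p) (hess_bound C U f p0).
split.
  apply: neighborhood_sub; have := seg 1; rewrite scale1r subrKC; apply.
  by rewrite lexx ler01.
rewrite subrKC in taylor; apply: le_trans (taylor _) _.
  move=> t /seg Kt; have [df dg _] := f_C2 (neighborhood_sub Kt); split => //.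
  apply: le_trans (quadform_le_specnorm _ _) _.
  by rewrite ler_wpM2r ?dot_ge0// specnorm_le_bound.
rewrite -enorm_sq; move: hd (sqr_ge0 (enorm (q - p))).
move: (dot _ _) (enorm _ ^+ 2) => D N hd N0.
(* Forced by [0 < a * L <= 2 (1 - sigma)]. *)
have s1 : 0 < 1 - sigma by have := mulr_gt0 a0 L0; lra.
have h1 : (1 - sigma) * (a * D + N) <= 0 by rewrite pmulr_rle0//; lra.
have h2 : (a * hess_bound C U f p0 - 2 * (1 - sigma)) * N <= 0.
  by rewrite mulr_le0_ge0// subr_le0.
have : a * ((1 - sigma) * D + hess_bound C U f p0 / 2 * N) <= 0 by lra.
by rewrite pmulr_rle0//; lra.
Qed.

(** Either the initial step is accepted, or the accepted step is [rho] times a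
    rejected one, which is larger than [alpha_star] by [accepted_small]. *)
Lemma backtracking_bounds (sigma rho : R) p (a b : R) : F0 p ->
  0 < rho -> rho < 1 -> 0 < a -> backtracking C U f sigma rho p a b ->
  [/\ accepted C U f sigma p b, b <= a
    & Num.min a (rho * alpha_star C U f sigma p0) <= b].
Proof.
move=> Fp rho0 rho1 + bt; elim: bt => {a b} [a acc a0|a b nacc _ IH a0].
  by split => //; rewrite ge_min lexx.
have [acc ba lb] := IH (mulr_gt0 rho0 a0).
have ra : rho * a <= a by rewrite ger_pMl; [exact: ltW|exact: a0].
have aa : alpha_star C U f sigma p0 < a.
  by rewrite ltNge; apply/negP => /(accepted_small Fp a0).
clear nacc IH; split; [exact: acc|exact: le_trans ba ra|].
rewrite ge_min; apply/orP; right; apply: le_trans lb.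
by rewrite le_min lexx andbT ler_pM2l// ltW.
Qed.

End Sets.

(** * Convergence rates *)

Lemma sum_le_telescope (R : realType) (g h : nat -> R) N :
  (forall k, (k < N)%N -> g k <= h k - h k.+1) ->
  \sum_(0 <= k < N) g k <= h 0%N - h N.
Proof.
move=> gh; apply: (@le_trans _ _ (\sum_(0 <= k < N) (- h k.+1 - - h k))).
  by apply: ler_sum_nat => k /andP[_ /gh]; rewrite opprK addrC.
by rewrite (telescope_sumr (fun k => - h k))// opprK addrC.
Qed.

Section Convergence.
Context {R : realType} {n : nat}.
Variables (C U : set 'rV[R]_n) (f : 'rV[R]_n -> R) (abar sigma rho : R).
Variables (p0 pstar : 'rV[R]_n) (p : nat -> 'rV[R]_n) (alpha : nat -> R).
Hypothesis C_compact : compact C.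
Hypothesis C_convex : @convex_set R 'rV[R]_n C.
Hypothesis f_C2 : twice_continuously_differentiable U f.
Hypothesis f_convex : @convex_function R 'rV[R]_n U f.
Hypothesis f_blowup : boundary_blowup C U f.
Hypothesis p0_CU : (C `&` U) p0.
Hypothesis abar_gt0 : 0 < abar.
Hypothesis sigma_gt0 : 0 < sigma.
Hypothesis sigma_lt1 : sigma < 1.
Hypothesis rho_gt0 : 0 < rho.
Hypothesis rho_lt1 : rho < 1.
Hypothesis pstar_min : minimizer (C `&` U) f pstar.

Let C_nonempty : C !=set0. Proof. by exists p0; case: p0_CU. Qed.
Let G k := enorm (gradient_mapping C f (alpha k) (p k)).
Let a := alpha_low C U f abar sigma rho p0.
Let F0 := sublevel C U f (f p0).

Lemma alpha_low_gt0 : 0 < a.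
Proof. by rewrite lt_min abar_gt0 mulr_gt0// alpha_star_gt0. Qed.

Section Iterations.
Variable N : nat.
Hypothesis gen : generated C U f abar sigma rho 0 p0 p alpha N.

Let step_facts k : (k < N)%N -> F0 (p k) ->
  [/\ (C `&` U) (p k.+1),
      f (p k.+1) <= f (p k) + sigma * dot (grad f (p k)) (p k.+1 - p k)
    & a <= alpha k <= abar].
Proof.
case: gen => _ /[apply] -[bt _ ->] Fk.
have [[Uq armijo] ab la] := backtracking_bounds C_compact f_C2 f_blowup p0_CU
  C_convex Fk rho_gt0 rho_lt1 abar_gt0 bt.
split => //; last by rewrite ab andbT.
by split => //; exact: proj_in.
Qed.

Let step_descent k : (k < N)%N -> F0 (p k) ->
  alpha k * dot (grad f (p k)) (p k.+1 - p k) <= - enorm (p k.+1 - p k) ^+ 2.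
Proof.
move=> kN [[Ck _] _]; case: gen => _ /(_ _ kN)[_ _ ->].
exact: trial_descent.
Qed.

(** Backtracking is controlled only from points of the initial sublevel set,
    whence an induction: the accepted step decreases [f]. *)
Lemma iterates_in_sublevel k : (k <= N)%N -> F0 (p k).
Proof.
elim: k => [_|k IH kN]; first by case: gen => -> _; split.
have Fk := IH (ltnW kN); have [CUk armijo /andP[la _]] := step_facts kN Fk.
split => //; apply: le_trans (proj2 Fk); apply: (le_trans armijo).
have := step_descent kN Fk; have := sqr_ge0 (enorm (p k.+1 - p k)).
have ak : 0 < alpha k by apply: lt_le_trans la; exact: alpha_low_gt0.
move: (dot _ _) (_ ^+ 2) => D M M0 DM.
have : D <= 0 by rewrite -(pmulr_rle0 _ ak); lra.
by move=> D0; rewrite gerDl pmulr_rle0.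
Qed.

Let alpha_bounds k : (k < N)%N -> a <= alpha k <= abar.
Proof. by move=> kN; have [] := step_facts kN (iterates_in_sublevel (ltnW kN)). Qed.

Let alpha_gt0 k : (k < N)%N -> 0 < alpha k.
Proof.
by move=> /alpha_bounds/andP[la _]; apply: lt_le_trans la; exact: alpha_low_gt0.
Qed.

(** The step is [alpha k] times the gradient mapping, so [trial_descent] and
    the Armijo test give this with [alpha k] in place of its lower bound
    [a]. *)
Lemma sufficient_decrease k : (k < N)%N ->
  sigma * a * G k ^+ 2 <= f (p k) - f (p k.+1).
Proof.
move=> kN; have Fk := iterates_in_sublevel (ltnW kN).
have [_ armijo /andP[la _]] := step_facts kN Fk.
have ak := alpha_gt0 kN.
have := step_descent kN Fk.
have -> : enorm (p k.+1 - p k) = alpha k * G k.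
  rewrite /G /gradient_mapping enormZ ger0_norm ?invr_ge0 ?(ltW ak)//.
  rewrite mulrA divff ?gt_eqF// mul1r enorm_distC.
  by case: gen => _ /(_ _ kN)[_ _ ->].
rewrite exprMn expr2 -mulrA -mulrN ler_pM2l// => h.
have aG : a * G k ^+ 2 <= alpha k * G k ^+ 2 by rewrite ler_wpM2r ?sqr_ge0.
have : sigma * (a * G k ^+ 2) <= sigma * - dot (grad f (p k)) (p k.+1 - p k).
  by rewrite ler_pM2l//; lra.
lra.
Qed.

(** Expand the squared distances to [pstar], bound the cross terms by
    [proj_obtuse] at [pstar] and by convexity; the term left over,
    [- dot (grad f (p k)) (p k.+1 - p k)], is at most
    [(f (p k) - f (p k.+1)) / sigma] by the Armijo test. *)
Lemma distance_decrease k : (k < N)%N ->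
  2 * a * (f (p k) - f pstar) <=
    enorm (p k - pstar) ^+ 2 - enorm (p k.+1 - pstar) ^+ 2
    + 2 * abar / sigma * (f (p k) - f (p k.+1)).
Proof.
move=> kN; have Fk := iterates_in_sublevel (ltnW kN).
have [CUk1 armijo /andP[la lb]] := step_facts kN Fk.
have ak := alpha_gt0 kN.
have [[Ck Uk] _] := Fk; have [[Cs Us] smin] := pstar_min.
have [df _ _] := f_C2 Uk.
have cvx := convex_gradient_le f_convex Uk Us df.
have obt := proj_obtuse C_nonempty C_compact C_convex
  (p k - alpha k *: grad f (p k)) Cs.
have E : p k.+1 = Defs.proj C (p k - alpha k *: grad f (p k)).
  by case: gen => _ /(_ _ kN)[_ _ ->].
rewrite -E in obt.
have dk : 0 <= f (p k) - f pstar by rewrite subr_ge0; apply: smin.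
have dec : 0 <= (f (p k) - f (p k.+1)) / sigma.
  rewrite divr_ge0 ?(ltW sigma_gt0)//; apply: le_trans (sufficient_decrease kN).
  by rewrite mulr_ge0 ?sqr_ge0// mulr_ge0 ?ltW// alpha_low_gt0.
have arm : - dot (grad f (p k)) (p k.+1 - p k) <= (f (p k) - f (p k.+1)) / sigma.
  by rewrite ler_pdivlMr//; lra.
set A := _ / sigma in dec arm.
have -> : 2 * abar / sigma * (f (p k) - f (p k.+1)) = 2 * (abar * A).
  by rewrite /A; field; rewrite gt_eqF.
have h1 : a * (f (p k) - f pstar) <= alpha k * (f (p k) - f pstar).
  by rewrite ler_wpM2r.
have h2 : alpha k * A <= abar * A by rewrite ler_wpM2r.
have h3 : alpha k * - dot (grad f (p k)) (p k.+1 - p k) <= alpha k * A.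
  by rewrite ler_pM2l.
have h4 : alpha k * dot (grad f (p k)) (pstar - p k)
    <= alpha k * (f pstar - f (p k)).
  by rewrite ler_pM2l.
have h5 := dot_ge0 (p k.+1 - p k).
rewrite !enorm_sq.
have expand :
    dot (p k - pstar) (p k - pstar) - dot (p k.+1 - pstar) (p k.+1 - pstar)
    = dot (p k.+1 - p k) (p k.+1 - p k)
      - 2 * alpha k * (dot (grad f (p k)) (pstar - p k)
                       - dot (grad f (p k)) (p k.+1 - p k))
      - 2 * dot (p k - alpha k *: grad f (p k) - p k.+1) (pstar - p k.+1).
  move: (p k) (p k.+1) (grad f (p k)) => x y g.
  rewrite !dotE (dotC y x) (dotC pstar x) (dotC pstar y).
  ring.
lra.
Qed.

Lemma values_noninc i j : (i <= j)%N -> (j <= N)%N -> f (p j) <= f (p i).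
Proof.
elim: j => [|j IH]; first by rewrite leqn0 => /eqP->.
rewrite leq_eqVlt => /predU1P[->//|ij] jN.
apply: le_trans (IH ij (ltnW jN)); rewrite -subr_ge0.
apply: le_trans (sufficient_decrease jN).
by rewrite mulr_ge0 ?sqr_ge0// mulr_ge0 ?ltW// alpha_low_gt0.
Qed.

Lemma min_le_value k : (k <= N)%N -> f pstar <= f (p k).
Proof. by move=> /iterates_in_sublevel[+ _]; exact: (proj2 pstar_min). Qed.

Lemma sum_gradient_mapping_sq :
  \sum_(0 <= k < N) G k ^+ 2 <= (f p0 - f pstar) / (sigma * a).
Proof.
have sa : 0 < sigma * a by rewrite mulr_gt0// alpha_low_gt0.
rewrite ler_pdivlMr// mulrC mulr_sumr.
apply: (le_trans (sum_le_telescope sufficient_decrease)).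
by rewrite lerB ?min_le_value//; case: gen => ->.
Qed.

Lemma sum_value_gap :
  2 * a * \sum_(0 <= k < N) (f (p k) - f pstar) <=
    enorm (p0 - pstar) ^+ 2 + 2 * abar * (f p0 - f pstar) / sigma.
Proof.
rewrite mulr_sumr.
(* The Lyapunov function whose decrease bounds the gap in function values. *)
pose h k := enorm (p k - pstar) ^+ 2 + 2 * abar / sigma * f (p k).
apply: (le_trans (@sum_le_telescope _ _ h N _)).
  by move=> k /distance_decrease; rewrite /h; lra.
have p00 : p 0 = p0 by case: gen.
rewrite /h p00.
have c0 : 0 <= 2 * abar / sigma by rewrite divr_ge0 ?mulr_ge0 ?ltW.
have := ler_wpM2l c0 (min_le_value (leqnn N)).
have := sqr_ge0 (enorm (p N - pstar)).
rewrite (_ : 2 * abar * _ / sigma = 2 * abar / sigma * (f p0 - f pstar));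
  last by ring.
lra.
Qed.

End Iterations.

Lemma min_gradient_mapping_le K :
  generated C U f abar sigma rho 0 p0 p alpha K.+1 ->
  \big[Num.min/G 0%N]_(0 <= k < K.+1) G k
    <= Num.sqrt ((f p0 - f pstar) / (sigma * a * K.+1%:R)).
Proof.
move=> gen; set m := \big[_/_]_(_ <= _ < _) _.
have m0 : 0 <= m by apply: le_bigmin => [|i _]; exact: enorm_ge0.
have mG k : (k < K.+1)%N -> m <= G k.
  by move=> kK; apply: (ge_bigmin_seq _ k); rewrite ?mem_index_iota.
rewrite -(ger0_norm m0) -sqrtr_sqr; apply: ler_wsqrtr.
rewrite invfM mulrA ler_pdivlMr ?ltr0n//.
apply: le_trans (sum_gradient_mapping_sq gen).
rewrite mulr_natr -[X in _ *+ X]subn0 -sumr_const_nat.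
by apply: ler_sum_nat => k /andP[_ kK]; rewrite lerXn2r ?nnegrE ?enorm_ge0 ?mG.
Qed.

Lemma value_gap_le K :
  generated C U f abar sigma rho 0 p0 p alpha K.+1 ->
  f (p K) - f pstar
    <= (enorm (p0 - pstar) ^+ 2 + 2 * abar * (f p0 - f pstar) / sigma)
       / (2 * a * K.+1%:R).
Proof.
move=> gen; have a2 : 0 < 2 * a by rewrite mulr_gt0// alpha_low_gt0.
rewrite ler_pdivlMr ?mulr_gt0 ?alpha_low_gt0 ?ltr0n//.
apply: le_trans (sum_value_gap gen).
rewrite mulrCA ler_pM2l// mulr_natr -[X in _ *+ X]subn0 -sumr_const_nat.
apply: ler_sum_nat => k /andP[_ kK].
by rewrite lerB//; exact: (@values_noninc _ gen k K kK (leqnSn K)).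
Qed.

Lemma gradient_mapping_summable :
  (forall N, generated C U f abar sigma rho 0 p0 p alpha N) ->
  (\sum_(0 <= k <oo) (G k ^+ 2)%:E
     <= ((f p0 - f pstar) / (sigma * a))%:E)%E
  /\ G k @[k --> \oo] --> (0 : R).
Proof.
move=> gen; split.
  apply: lime_le.
    by apply: is_cvg_nneseries => k _ _; rewrite lee_fin sqr_ge0.
  apply: nearW => N.
  by rewrite sumEFin lee_fin; exact: sum_gradient_mapping_sq.
have G2 : (fun k => G k ^+ 2) @ \oo --> (0 : R).
  apply: cvg_series_cvg_0; apply: nondecreasing_is_cvgn.
    by apply: nondecreasing_series => k _ _; exact: sqr_ge0.
  exists ((f p0 - f pstar) / (sigma * a)) => _ [N _ <-].
  by rewrite seriesEnat; exact: sum_gradient_mapping_sq.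
have -> : G = Num.sqrt \o (fun k => G k ^+ 2).
  by apply/funext => k /=; rewrite sqrtr_sqr ger0_norm// enorm_ge0.
rewrite -[0]sqrtr0.
exact: (cvg_comp _ _ G2 (@sqrt_continuous R 0)).
Qed.

End Convergence.

Theorem theorem2 (R : realType) (n : nat) (C U : set 'rV[R]_n)
    (f : 'rV[R]_n -> R) (abar sigma rho : R) (p0 pstar : 'rV[R]_n)
    (p : nat -> 'rV[R]_n) (alpha : nat -> R)
    (C_nonempty : C !=set0) (C_compact : compact C)
    (C_convex : @convex_set R 'rV[R]_n C)
    (U_open : open U) (U_convex : @convex_set R 'rV[R]_n U)
    (CU_nonempty : C `&` U !=set0)
    (f_C2 : twice_continuously_differentiable U f)
    (f_convex : @convex_function R 'rV[R]_n U f)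
    (f_blowup : boundary_blowup C U f)
    (p0_CU : (C `&` U) p0)
    (abar_gt0 : 0 < abar)
    (sigma_gt0 : 0 < sigma) (sigma_lt1 : sigma < 1)
    (rho_gt0 : 0 < rho) (rho_lt1 : rho < 1)
    (pstar_min : minimizer (C `&` U) f pstar) :
  let G k := enorm (gradient_mapping C f (alpha k) (p k)) in
  let a := alpha_low C U f abar sigma rho p0 in
  (forall K : nat,
     generated C U f abar sigma rho 0 p0 p alpha K.+1 ->
     \big[Num.min/G 0%N]_(0 <= k < K.+1) G k
       <= Num.sqrt ((f p0 - f pstar) / (sigma * a * K.+1%:R))
     /\ f (p K) - f pstar
       <= (enorm (p0 - pstar) ^+ 2 + 2 * abar * (f p0 - f pstar) / sigma)
          / (2 * a * K.+1%:R))
  /\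
  ((forall N : nat, generated C U f abar sigma rho 0 p0 p alpha N) ->
     (\sum_(0 <= k <oo) (G k ^+ 2)%:E
        <= ((f p0 - f pstar) / (sigma * a))%:E)%E
     /\ G k @[k --> \oo] --> (0 : R)).
Proof.
move=> G a; split=> [K gen|gen].
  split; first exact: min_gradient_mapping_le.
  exact: (value_gap_le C_compact C_convex f_C2 f_convex f_blowup p0_CU abar_gt0
    sigma_gt0 sigma_lt1 rho_gt0 rho_lt1 pstar_min gen).
exact: gradient_mapping_summable.
Qed.
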